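(* Let $M=G/K$ be a Riemannian symmetric space of compact type with decomposition $\mathfrak g=\mathfrak k\oplus\mathfrak m$, let $\mathfrak m'\subset\mathfrak m$ be a Lie triple system, and let $\mathfrak a$ be a Cartan subalgebra of $\mathfrak m$ such that $\mathfrak a':=\mathfrak a\cap\mathfrak m'$ is a Cartan subalgebra of $\mathfrak m'$. (a) The roots and root spaces of $\mathfrak m$ and of $\mathfrak m'$ are related by $$\mathfrak m'_0=\mathfrak a',$$ $$\Delta(\mathfrak m',\mathfrak a')\subset\{\lambda|_{\mathfrak a'}\mid\lambda\in\Delta(\mathfrak m,\mathfrak a),\ \lambda|_{\mathfrak a'}\neq0\},$$ $$\forall\alpha\in\Delta(\mathfrak m',\mathfrak a'):\quad\mathfrak m'_\alpha=\Bigl(\bigoplus_{\lambda\in\Delta(\mathfrak m,\mathfrak a),\ \lambda|_{\mathfrak a'}=\alpha}\mathfrak m_\lambda\Bigr)\cap\mathfrak m'.$$ (b) We have $\mathrm{rk}(\mathfrak m')=\mathrm{rk}(\mathfrak m)$ if and only if $\mathfrak a'=\mathfrak a$. If this is the case, then $$\Delta(\mathfrak m',\mathfrak a')\subset\Delta(\mathfrak m,\mathfrak a)\quad\text{and}\quad\forall\alpha\in\Delta(\mathfrak m',\mathfrak a'):\ \mathfrak m'_\alpha=\mathfrak m_\alpha\cap\mathfrak m'.$$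
   Context: $M=G/K$ is a Riemannian symmetric space of compact type, $\mathfrak g=\mathfrak k\oplus\mathfrak m$ is the decomposition of the Lie algebra of $G$ induced by the symmetric structure; the Killing form $\varkappa$ of $\mathfrak g$ is negative definite, and $\langle\cdot,\cdot\rangle=-c\,\varkappa$ for some fixed $c>0$. A linear subspace $\mathfrak m'\subset\mathfrak m$ is a Lie triple system if $[[\mathfrak m',\mathfrak m'],\mathfrak m']\subset\mathfrak m'$. A linear subspace $\mathfrak a$ is flat if $[\mathfrak a,\mathfrak a]=\{0\}$. For $\mathfrak m$ (and likewise for a Lie triple system $\mathfrak m'$), the rank $\mathrm{rk}$ is the maximal dimension of a flat subspace contained in it, and a Cartan subalgebra is a flat subspace of it whose dimension equals the rank. For a Cartan subalgebra $\mathfrak a\subset\mathfrak m$ and $\lambda\in\mathfrak a^*$ put $\mathfrak m_\lambda=\{X\in\mathfrak m\mid\forall Z\in\mathfrak a:\ \mathrm{ad}(Z)^2X=-\lambda(Z)^2X\}$ and $\Delta(\mathfrak m,\mathfrak a)=\{\lambda\in\mathfrak a^*\setminus\{0\}\mid\mathfrak m_\lambda\ne\{0\}\}$. For a Cartan subalgebra $\mathfrak a'$ of the Lie triple system $\mathfrak m'$ and $\alpha\in(\mathfrak a')^*$ put $\mathfrak m'_\alpha=\{X\in\mathfrak m'\mid\forall Z\in\mathfrak a':\ \mathrm{ad}(Z)^2X=-\alpha(Z)^2X\}$. The Lie triple system decomposes as $\mathfrak m'=\mathfrak m'_{fl}\oplus\mathfrak m'_c$ into Lie triple systems with $\mathfrak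 m'_{fl}$ flat, $[\mathfrak m',\mathfrak m'_{fl}]=\{0\}$ and $\mathfrak m'_c$ of compact type, and $\mathfrak a'=\mathfrak m'_{fl}\oplus\mathfrak a'_c$ with a Cartan subalgebra $\mathfrak a'_c$ of $\mathfrak m'_c$; $\Delta(\mathfrak m',\mathfrak a')$ is the set of those $\alpha\in(\mathfrak a')^*$ with $\alpha|_{\mathfrak m'_{fl}}=0$ whose restriction to $\mathfrak a'_c$ is a root of $\mathfrak m'_c$ with respect to $\mathfrak a'_c$; equivalently $\Delta(\mathfrak m',\mathfrak a')=\{\alpha\in(\mathfrak a')^*\setminus\{0\}\mid\mathfrak m'_\alpha\neq\{0\}\}$. *)

(* Defs.v *)
From HB Require Import structures.
From mathcomp Require Import all_boot all_order all_algebra.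
From mathcomp Require Import boolp classical_sets reals.
Set Implicit Arguments.
Unset Strict Implicit.
Unset Printing Implicit Defensive.

Import Order.TTheory GRing.Theory Num.Theory.
Local Open Scope ring_scope.

HB.mixin Record Vector_isLie (R : fieldType) g of Vector R g := {
  lie : g -> g -> g;
  lie_linearl : forall z, linear (lie^~ z);
  lie_linearr : forall x, linear (lie x);
  liexx : forall x, lie x x = 0;
  lie_jacobi : forall x y z,
    lie x (lie y z) + lie y (lie z x) + lie z (lie x y) = 0
}.

#[short(type="lieAlgType")]
HB.structure Definition LieAlgebra (R : fieldType) :=
  { g of Vector R g & Vector_isLie R g }.

Section LieAlgebraTheory.
Variables (R : fieldType) (g : lieAlgType R).

HB.instance Definition _ (x : g) :=
  GRing.isLinear.Build R g g *:%R (lie x) (lie_linearr x).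

Definition ad (x : g) : 'End(g) := linfun (lie x).

Lemma adE (x y : g) : ad x y = lie x y.
Proof. by rewrite lfunE. Qed.

Definition lfun_trace (f : 'End(g)) : R :=
  \tr (passmx.mxof (vbasis {:g}) (vbasis {:g}) f).

Definition killing (x y : g) : R := lfun_trace (ad x \o ad y)%VF.

Definition flat (a : {vspace g}) : Prop :=
  forall x y, x \in a -> y \in a -> lie x y = 0.

Definition rk (U : {vspace g}) : nat :=
  \max_(d < (\dim U).+1 |
        `[< exists a : {vspace g}, [/\ (a <= U)%VS, flat a & \dim a = d] >]) d.

Definition cartan_subalgebra (U a : {vspace g}) : Prop :=
  [/\ (a <= U)%VS, flat a & \dim a = rk U].

Definition lie_triple_system (U : {vspace g}) : Prop :=
  forall x y z, x \in U -> y \in U -> z \in U -> lie (lie x y) z \in U.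

End LieAlgebraTheory.

(* The infinitesimal data of a Riemannian symmetric space G/K of compact type:
   the differential at the identity of the involution of G, and the invariant
   inner product. *)
Record compact_symmetric (R : realType) (g : lieAlgType R) := CompactSymmetric {
  symm : 'End(g);
  symm_lie : forall x y, symm (lie x y) = lie (symm x) (symm y);
  symm_invol : (symm \o symm)%VF = \1%VF;
  killing_lt0 : forall x : g, x != 0 -> killing x x < 0;
  metric : g -> g -> R;
  metric_killing :
    exists2 c : R, 0 < c & forall x y, metric x y = - c * killing x y
}.

Section SymmetricDecomposition.
Variables (R : realType) (g : lieAlgType R) (M : compact_symmetric g).

Definition kpart : {vspace g} := fixedSpace (symm M).
Definition mpart : {vspace g} := passmx.leigenspace (symm M) (-1).

Lemma mpartP (x : g) : (x \in mpart) = (symm M x == - x).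
Proof.
by rewrite memv_ker add_lfunE opp_lfunE scale_lfunE id_lfunE scaleN1r subr_eq0.
Qed.

Lemma kpart_mpart : (kpart + mpart)%VS = fullv /\ directv (kpart + mpart).
Proof.
have s2 x : symm M (symm M x) = x.
  by have := symm_invol M => /lfunP/(_ x); rewrite comp_lfunE id_lfunE.
have n2 : (2%:R : R) != 0 by rewrite pnatr_eq0.
split.
  apply/vspaceP => x; rewrite memvf.
  have -> : x = 2%:R^-1 *: (x + symm M x) + 2%:R^-1 *: (x - symm M x).
    rewrite -scalerDr addrACA subrr addr0 -mulr2n -[x *+ 2]scaler_nat.
    by rewrite scalerA mulVf // scale1r.
  apply: memv_add; apply: memvZ.
    by apply/fixedSpaceP; rewrite linearD /= s2 addrC.
  by rewrite mpartP linearB /= s2 opprB.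
rewrite directv_addE /= !directvE /= !eqxx /=; apply/eqP/vspaceP => x.
rewrite memv_cap memv0 mpartP; apply/andP/eqP => [[/fixedSpaceP -> /eqP xN]|->].
  have : 2%:R *: x = 0 by rewrite scaler_nat mulr2n {1}xN addNr.
  by move/eqP; rewrite scaler_eq0 (negPf n2) => /eqP.
by rewrite mem0v linear0 oppr0 eqxx.
Qed.

End SymmetricDecomposition.

Section SetSubspace.
Variables (K : fieldType) (V : vectType K).
Local Open Scope classical_set_scope.

(* The subspace whose set of elements is A, for A a linear subspace. *)
Definition vspace_of (A : set V) : {vspace V} :=
  xget 0%VS [set U : {vspace V} | forall x, x \in U <-> A x].

Lemma mem_vspace_of (A : set V) (x : V) :
  A 0 -> (forall c y z, A y -> A z -> A (c *: y + z)) ->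
  x \in vspace_of A <-> A x.
Proof.
move=> A0 AL.
pose P d := `[< exists U : {vspace V},
  \dim U = d /\ forall y, y \in U -> A y >].
have P0 : exists d, P d.
  exists 0; apply/asboolP; exists 0%VS; rewrite dimv0; split=> // y.
  by rewrite memv0 => /eqP ->.
have Pb d : P d -> (d <= \dim {:V})%N.
  by move=> /asboolP[U [<- _]]; rewrite dimvS ?subvf.
have [_ /asboolP[U [<- UA]] Umax] := ex_maxnP P0 Pb.
suff UE : forall y, y \in U <-> A y.
  by rewrite /vspace_of; case: xgetP => [W _ WE|/(_ U)//]; exact: WE.
move=> y; split=> [|Ay]; first exact: UA.
suff le : (\dim (U + <[y]>) <= \dim U)%N.
  have /eqP -> : U == (U + <[y]>)%VS by rewrite eqEdim addvSl le.
  by have := memv_add (mem0v U) (memv_line y); rewrite add0r.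
apply: Umax; apply/asboolP; exists (U + <[y]>)%VS; split=> // z.
move=> /memv_addP[u uU [_ /vlineP[c ->] ->]].
by rewrite addrC; apply: AL => //; exact: UA.
Qed.

Definition is_direct_sum (I : eqType) (D : set I) (F : I -> {vspace V})
    (U : {vspace V}) : Prop :=
  exists s : seq I, [/\ uniq s, (forall i, i \in s <-> D i),
    directv (\sum_(i <- s) F i) & U = (\sum_(i <- s) F i)%VS].

End SetSubspace.

Section Roots.
Variables (R : realType) (g : lieAlgType R).
Implicit Types (U a : {vspace g}).
Local Open Scope classical_set_scope.

Definition dualv a := 'Hom(subvs_of a, R^o).

(* Junk unless (a' <= a)%VS. *)
Definition restr_dual a a' (l : dualv a) : dualv a' :=
  linfun (l \o vsproj a \o vsval : subvs_of a' -> R^o).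

Lemma restr_dualE a a' (l : dualv a) (z : subvs_of a') (w : subvs_of a) :
  vsval z = vsval w -> restr_dual a' l z = l w.
Proof. by move=> zw; rewrite lfunE /= zw vsvalK. Qed.

Definition root_space U a (l : dualv a) : {vspace g} :=
  vspace_of [set x | x \in U /\
    forall z : subvs_of a, (ad (vsval z) \o ad (vsval z))%VF x
                           = - (l z) ^+ 2 *: x].

Lemma root_spaceP U a (l : dualv a) x :
  x \in root_space U l <->
  x \in U /\ forall z : subvs_of a,
    lie (vsval z) (lie (vsval z) x) = - (l z) ^+ 2 *: x.
Proof.
rewrite mem_vspace_of /=.
- by split=> -[xU xl]; split=> // z; have := xl z; rewrite comp_lfunE !adE.
- by split=> [|z]; rewrite ?mem0v // linear0 scaler0.
move=> c y z [yU yl] [zU zl]; split=> [|w]; first by rewrite memvD ?memvZ.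
by rewrite linearP /= yl zl scalerDr !scalerA mulrC.
Qed.

Definition lie_roots U a : set (dualv a) :=
  [set l | l != 0 /\ root_space U l != 0%VS].

End Roots.

Arguments lie_roots {R g} U a.

(* Main.v *)
Require Import Defs.
From HB Require Import structures.
From mathcomp Require Import all_boot all_order all_algebra.
From mathcomp Require Import boolp classical_sets reals complex.
Set Implicit Arguments.
Unset Strict Implicit.
Unset Printing Implicit Defensive.
Import Order.TTheory GRing.Theory Num.Theory.
Local Open Scope classical_set_scope.
Local Open Scope ring_scope.

(** For a linear form [al] on [a'], let [W] be the root space of [al] formed in
    the big space [mpart M] rather than in [m'].  By definition the root space
    of [al] in [m'] is the intersection of [W] with [m'], so everything about
    nonzero roots reduces to showing that [W] is the direct sum of the root
    spaces of those roots of [mpart M] that restrict to [al]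
    ([restricted_root_space_direct_sum]).

    Since the opposite of the Killing form is an inner product for which every
    [ad z] is skew, the operators [ad z \o ad w] with [z], [w] in [a] are
    symmetric, and they commute because [a] is flat.  They preserve [W], as [a']
    lies in [a], so [W] is spanned by common eigenvectors
    ([span_common_eigenvectors]).  On such an eigenvector [v] the eigenvalues
    form a negative semidefinite bilinear form [b] on [a]; computing
    [ad z (ad w (ad z (ad w v)))] in two ways gives
    [b z w ^+ 2 = b z z * b w w], so [b] has rank at most one and is
    [- l z * l w] for a linear form [l] on [a]
    ([common_eigenvector_root_space]).  On [a'] the squares of [l] and [al]
    agree, so [l] restricts to [al] or to [- al]; changing the sign of [l], which
    does not change its root space, makes it restrict to [al]
    ([root_of_root_space_vector]).

    The sum is direct because root spaces of forms with different squares are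
    orthogonal ([root_spaces_orthogonal]), and two distinct forms with the same
    nonzero restriction cannot be opposite.  The same orthogonality shows that
    no root restricting to [al] is missing.

    The root space of [0] equals [a'] because [ad z (ad z x) = 0] forces
    [ad z x = 0] by skewness, after which [x] could be added to the maximal flat
    [a'] ([root_space0_cartan]).  The rank criterion is a count of
    dimensions, [a'] being contained in [a]. *)

(** * Commuting symmetric operators *)

Section RealEigenvector.
Variables (R : rcfType) (V : vectType R).

(** The real and imaginary parts of a complex eigenvector of the matrix of [T]
    on [U], for the eigenvalue [a + i b]. *)
Lemma complex_eigenvector (T : 'End(V)) (U : {vspace V}) :
  U != 0%VS -> (forall x, x \in U -> T x \in U) ->
  exists (a b : R) (u w : V), [/\ u \in U, w \in U, (u != 0) || (w != 0),
    T u = a *: u - b *: w & T w = a *: w + b *: u].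
Proof.
move=> U0 TU; set n := \dim U; pose e := vbasis U.
have eU (i : 'I_n) : e`_i \in U.
  by apply: vbasis_mem; rewrite mem_nth ?size_tuple.
pose A : 'M[R]_n := \matrix_(i, j) coord e j (T e`_i).
pose AC : 'M[R[i]]_n := map_mx (real_complex R) A.
have [c] : exists c, root (char_poly AC) c.
  by apply/closed_rootP; rewrite size_char_poly eqSS dimv_eq0.
rewrite -eigenvalue_root_char => /eigenvalueP[v vE v0].
pose lc (f : 'I_n -> R) : V := \sum_i f i *: e`_i.
have lcU f : lc f \in U by apply: memv_suml => i _; rewrite memvZ.
have Tlc f : T (lc f) = lc (fun j => \sum_i f i * A i j).
  rewrite linear_sum /=; under eq_bigr => i _.
    rewrite linearZ /= (coord_vbasis (TU _ (eU i))) scaler_sumr; over.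
  rewrite exchange_big /=; apply: eq_bigr => j _.
  by rewrite scaler_suml; apply: eq_bigr => i _; rewrite mxE scalerA.
have ReD : {morph @complex.Re R : x y / x + y} by move=> [? ?] [? ?].
have ImD : {morph @complex.Im R : x y / x + y} by move=> [? ?] [? ?].
have row j : \sum_i v 0 i * AC i j = c * v 0 j.
  by have /matrixP/(_ 0 j) := vE; rewrite !mxE.
pose a := complex.Re c; pose b := complex.Im c.
pose p i := complex.Re (v 0 i); pose q i := complex.Im (v 0 i).
have rowp j : \sum_i p i * A i j = a * p j - b * q j.
  have /(congr1 (@complex.Re R)) := row j.
  rewrite (big_morph _ ReD erefl) => E.
  transitivity (complex.Re (c * v 0 j)); last first.
    by rewrite /a /b /p /q; case: (c) (v 0 j) => ? ? [].
  rewrite -E; apply: eq_bigr => i _.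
  by rewrite /p /AC !mxE; case: (v 0 i) => x y /=; rewrite mulr0 subr0.
have rowq j : \sum_i q i * A i j = a * q j + b * p j.
  have /(congr1 (@complex.Im R)) := row j.
  rewrite (big_morph _ ImD erefl) => E.
  transitivity (complex.Im (c * v 0 j)); last first.
    by rewrite /a /b /p /q; case: (c) (v 0 j) => ? ? [].
  rewrite -E; apply: eq_bigr => i _.
  by rewrite /q /AC !mxE; case: (v 0 i) => x y /=; rewrite mulr0 add0r.
exists a, b, (lc p), (lc q); split=> //; last 2 first.
- rewrite Tlc /lc !scaler_sumr -sumrB; apply: eq_bigr => j _.
  by rewrite rowp scalerBl !scalerA.
- rewrite Tlc /lc !scaler_sumr -big_split; apply: eq_bigr => j _.
  by rewrite rowq scalerDl !scalerA.
rewrite -negb_and; apply: contra v0 => /andP[/eqP pE /eqP qE].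
have lc0 f j : lc f = 0 -> f j = 0.
  move=> f0; have := coord_sum_free f j (basis_free (vbasisP U)).
  by rewrite -/(lc f) f0 linear0.
apply/eqP/rowP => j; rewrite mxE; apply/eqP; rewrite eq_complex /=.
by rewrite -/(p j) -/(q j) (lc0 _ _ pE) (lc0 _ _ qE) eqxx.
Qed.

End RealEigenvector.

Definition inner_product (R : numDomainType) (V : lmodType R)
    (B : V -> V -> R) : Prop :=
  [/\ forall y, scalar (B^~ y), (forall x y, B x y = B y x)
    & forall x, x != 0 -> 0 < B x x].

Section InnerProduct.
Variables (R : numDomainType) (V : lmodType R) (B : V -> V -> R).
Hypothesis ipB : inner_product B.

Lemma ip_sym x y : B x y = B y x. Proof. by case: ipB. Qed.

Lemma ip_DZl c x y z : B (c *: x + y) z = c * B x z + B y z.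
Proof. by case: ipB => lB _ _; exact: lB. Qed.

Lemma ip_0l y : B 0 y = 0.
Proof. by have := ip_DZl (-1) 0 0 y; rewrite scaler0 addr0 mulN1r addNr. Qed.

Lemma ip_Dl x y z : B (x + y) z = B x z + B y z.
Proof. by have := ip_DZl 1 x y z; rewrite scale1r mul1r. Qed.

Lemma ip_Zl c x y : B (c *: x) y = c * B x y.
Proof. by have := ip_DZl c x 0 y; rewrite !addr0 ip_0l addr0. Qed.

Lemma ip_Nl x y : B (- x) y = - B x y.
Proof. by rewrite -scaleN1r ip_Zl mulN1r. Qed.

Lemma ip_Bl x y z : B (x - y) z = B x z - B y z.
Proof. by rewrite ip_Dl ip_Nl. Qed.

Lemma ip_Zr c x y : B x (c *: y) = c * B x y.
Proof. by rewrite ip_sym ip_Zl ip_sym. Qed.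

Lemma ip_Dr x y z : B x (y + z) = B x y + B x z.
Proof. by rewrite !(ip_sym x) ip_Dl. Qed.

Lemma ip_ge0 x : 0 <= B x x.
Proof.
have [->|x0] := eqVneq x 0; first by rewrite ip_0l.
by case: ipB => _ _ /(_ _ x0)/ltW.
Qed.

Lemma ip_eq0 x : (B x x == 0) = (x == 0).
Proof.
have [->|x0] := eqVneq x 0; first by rewrite ip_0l eqxx.
by case: ipB => _ _ /(_ _ x0); rewrite lt0r => /andP[/negPf].
Qed.

End InnerProduct.

Section CommutingSymmetricOperators.
Variables (R : rcfType) (V : vectType R) (B : V -> V -> R).
Hypothesis ipB : inner_product B.

(** Comparing [B (T u) w] with [B u (T w)] for the real and imaginary parts of
    a complex eigenvector gives [b * (B u u + B w w) = 0], so the eigenvalue is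
    real. *)
Lemma symmetric_eigenvector (T : 'End(V)) (U : {vspace V}) :
  (forall x y, B (T x) y = B x (T y)) -> U != 0%VS ->
  (forall x, x \in U -> T x \in U) ->
  exists (c : R) (x : V), [/\ x \in U, x != 0 & T x = c *: x].
Proof.
move=> symT U0 TU.
have [a [b [u [w [uU wU uw0 Tu Tw]]]]] := complex_eigenvector U0 TU.
have b0 : b = 0.
  have := symT u w; rewrite Tu Tw (ip_Bl ipB) (ip_Dr ipB).
  rewrite !(ip_Zl ipB) !(ip_Zr ipB).
  move/addrI/eqP; rewrite eq_sym -subr_eq0 opprK -mulrDr mulf_eq0 => /orP[/eqP//|].
  rewrite paddr_eq0 ?(ip_ge0 ipB) // !(ip_eq0 ipB) => /andP[/eqP u0 /eqP w0].
  by move: uw0; rewrite u0 w0 eqxx.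
move: Tu Tw; rewrite b0 !scale0r subr0 addr0 => Tu Tw.
by case/orP: uw0 => ?; [exists a, u | exists a, w].
Qed.

Variable P : set 'End(V).
Hypothesis symP : forall T, P T -> forall x y, B (T x) y = B x (T y).
Hypothesis comP : forall T S, P T -> P S -> forall x, T (S x) = S (T x).

(** Induction on [\dim U]: unless all operators are scalar on [U], some [T] has
    an eigenvalue [c] whose eigenspace in [U] is proper and nonzero.  By symmetry
    this eigenspace is orthogonal to the image of [U] under [T - c], hence by the
    rank formula complementary to it; both pieces are smaller and are preserved
    by everything commuting with [T]. *)
Lemma span_common_eigenvectors (U : {vspace V}) :
  (forall T, P T -> forall x, x \in U -> T x \in U) ->
  exists2 s : seq V, <<s>>%VS = U &
    forall x, x \in s -> forall T, P T -> exists c, T x = c *: x.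
Proof.
have [n] := ubnP (\dim U); elim: n U => // n IHn U; rewrite ltnS => dU PU.
have [scal|/existsNP[T /not_implyP[PT nscal]]] :=
  pselect (forall T, P T -> exists c, forall x, x \in U -> T x = c *: x).
  exists (vbasis U) => [|x /vbasis_mem xU T /scal[c Tc]].
    exact: span_basis (vbasisP U).
  by exists c; exact: Tc.
have U0 : U != 0%VS.
  apply/eqP => U0; apply: nscal; exists 0 => x.
  by rewrite U0 memv0 => /eqP ->; rewrite linear0 scaler0.
have [c [x [xU x0 Tx]]] := symmetric_eigenvector (symP PT) U0 (PU _ PT).
pose Tc := (T - c *: \1)%VF.
have TcE y : Tc y = T y - c *: y.
  by rewrite add_lfunE opp_lfunE scale_lfunE id_lfunE.
have kTc y : (y \in lker Tc) = (T y == c *: y).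
  by rewrite memv_ker TcE subr_eq0.
pose U1 := (U :&: lker Tc)%VS; pose U2 := (Tc @: U)%VS.
have dimU : (\dim U1 + \dim U2)%N = \dim U := limg_ker_dim Tc U.
have dU1 : (\dim U1 < \dim U)%N.
  rewrite ltn_neqAle dimvS ?capvSl // andbT; apply/negP => /eqP dE.
  apply: nscal; exists c => y yU.
  have /eqP U1E : U1 == U by rewrite eqEdim capvSl dE leqnn.
  by move: yU; rewrite -U1E memv_cap kTc => /andP[_ /eqP].
have dU2 : (\dim U2 < \dim U)%N.
  rewrite -dimU -[X in (X < _)%N]add0n ltn_add2r lt0n dimv_eq0.
  apply: contraNneq x0 => U10.
  by rewrite -memv0 -U10 memv_cap xU kTc Tx eqxx.
have PU1 S : P S -> forall y, y \in U1 -> S y \in U1.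
  move=> PS y; rewrite !memv_cap !kTc => /andP[yU /eqP Ty].
  by rewrite (PU _ PS) //= (comP PT PS) Ty linearZ.
have PU2 S : P S -> forall y, y \in U2 -> S y \in U2.
  move=> PS y /memv_imgP[z zU ->]; apply/memv_imgP; exists (S z).
    exact: PU.
  by rewrite !TcE linearB linearZ /= (comP PT PS).
have [s1 s1E P1] := IHn _ (leq_trans dU1 dU) PU1.
have [s2 s2E P2] := IHn _ (leq_trans dU2 dU) PU2.
exists (s1 ++ s2) => [|y]; last by rewrite mem_cat => /orP[/P1|/P2].
have U12 : (U1 :&: U2)%VS = 0%VS.
  apply/eqP; rewrite -subv0; apply/subvP => y.
  rewrite memv_cap memv0 memv_cap kTc => /andP[/andP[_ /eqP Ty]].
  move=> /memv_imgP[z _ yE]; rewrite -(ip_eq0 ipB) {1}yE TcE.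
  by rewrite (ip_Bl ipB) (symP PT) Ty (ip_Zl ipB) (ip_Zr ipB) subrr.
rewrite span_cat s1E s2E; apply/eqP.
rewrite eqEdim dimv_disjoint_sum // dimU leqnn andbT subv_add capvSl /=.
apply/subvP => y /memv_imgP[z zU ->].
by rewrite TcE memvB ?memvZ // (PU _ PT).
Qed.

End CommutingSymmetricOperators.

(** * Lie algebra identities and invariance of the Killing form *)

Section LieIdentities.
Variables (R : fieldType) (g : lieAlgType R).
Implicit Types x y z : g.

Lemma lieDl x y z : lie (x + y) z = lie x z + lie y z.
Proof. by have := lie_linearl z 1 x y; rewrite !scale1r. Qed.

Lemma lie0l z : lie (0 : g) z = 0.
Proof. by apply: (addrI (lie 0 z)); rewrite -lieDl !addr0. Qed.

Lemma lieZl c x z : lie (c *: x) z = c *: lie x z.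
Proof. by have := lie_linearl z c x 0; rewrite !addr0 lie0l addr0. Qed.

Lemma lieNl x z : lie (- x) z = - lie x z.
Proof. by rewrite -scaleN1r lieZl scaleN1r. Qed.

Lemma lieC x y : lie x y = - lie y x.
Proof.
have := liexx (x + y); rewrite lieDl !linearD /= !liexx add0r addr0.
by move/eqP; rewrite addr_eq0 => /eqP.
Qed.

Lemma lie_lie x y z : lie (lie x y) z = lie x (lie y z) - lie y (lie x z).
Proof.
have := lie_jacobi x y z; rewrite (lieC z (lie x y)) (lieC z x) linearN /=.
by move/eqP; rewrite subr_eq0 => /eqP <-.
Qed.

Lemma lie_comm x y z : lie x y = 0 -> lie x (lie y z) = lie y (lie x z).
Proof. by move=> xy; apply/eqP; rewrite -subr_eq0 -lie_lie xy lie0l. Qed.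

Lemma lfun_trace_comp (f h : 'End(g)) :
  lfun_trace (f \o h)%VF = \tr (passmx.mxof (vbasis {:g}) (vbasis {:g}) h
    *m passmx.mxof (vbasis {:g}) (vbasis {:g}) f).
Proof. by rewrite /lfun_trace (passmx.mxof_comp _ _ (vbasisP _)). Qed.

Lemma lfun_trace_compC (f h : 'End(g)) :
  lfun_trace (f \o h)%VF = lfun_trace (h \o f)%VF.
Proof. by rewrite !lfun_trace_comp mxtrace_mulC. Qed.

Lemma lfun_traceDZ c (f h : 'End(g)) :
  lfun_trace (c *: f + h)%VF = c * lfun_trace f + lfun_trace h.
Proof. by rewrite /lfun_trace passmx.mxof_linear mxtraceD mxtraceZ. Qed.

Lemma killingC x y : killing x y = killing y x.
Proof. exact: lfun_trace_compC. Qed.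

Lemma killing_scalar y : scalar (fun x : g => killing x y).
Proof.
move=> c x z; rewrite /killing -lfun_traceDZ; congr lfun_trace.
apply/lfunP => w; rewrite add_lfunE scale_lfunE !comp_lfunE !adE.
by rewrite lieDl lieZl.
Qed.

(** After expanding [ad] of a bracket as a commutator, this is invariance of the
    trace under cyclic permutations. *)
Lemma killing_lie x y z : killing (lie z x) y = - killing x (lie z y).
Proof.
have adlie (u v : g) :
    ad (lie u v) = (- 1 *: (ad v \o ad u) + (ad u \o ad v))%VF.
  apply/lfunP => w.
  by rewrite add_lfunE scale_lfunE !comp_lfunE !adE scaleN1r addrC lie_lie.
have killE (u v w : g) : killing (lie u v) w =
    - lfun_trace (ad v \o (ad u \o ad w))%VF
    + lfun_trace (ad u \o (ad v \o ad w))%VF.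
  rewrite -mulN1r -lfun_traceDZ /killing; congr lfun_trace; apply/lfunP => t.
  by rewrite add_lfunE scale_lfunE adlie !(comp_lfunE, add_lfunE, scale_lfunE).
rewrite (killingC x) !killE opprD opprK addrC; congr (_ + _).
  rewrite lfun_trace_compC -comp_lfunA lfun_trace_compC -comp_lfunA.
  by rewrite lfun_trace_compC -comp_lfunA.
by rewrite lfun_trace_compC -comp_lfunA.
Qed.

End LieIdentities.

(** * Maximality of Cartan subalgebras *)

Section Flats.
Variables (R : fieldType) (g : lieAlgType R).

Lemma flat_dim_le_rk (U b : {vspace g}) :
  (b <= U)%VS -> flat b -> (\dim b <= rk U)%N.
Proof.
move=> bU fb; have dU : (\dim b < (\dim U).+1)%N by rewrite ltnS dimvS.
apply: (bigop.bigmax_sup (Ordinal dU)) => //.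
by apply/asboolP; exists b.
Qed.

(** Otherwise [a + <[x]>] would be a flat subspace of [U] of dimension larger
    than the rank. *)
Lemma cartan_maximal (U a : {vspace g}) x : cartan_subalgebra U a ->
  x \in U -> (forall z, z \in a -> lie z x = 0) -> x \in a.
Proof.
move=> [aU fa dima] xU ax; pose b := (a + <[x]>)%VS.
have bU : (b <= U)%VS by rewrite subv_add aU -memvE.
have fb : flat b.
  move=> p q /memv_addP[u ua [p1 /vlineP[c ->] ->]].
  move=> /memv_addP[v va [q1 /vlineP[d ->] ->]].
  rewrite !lieDl !lieZl !linearD !linearZ /= (fa u v) // liexx (ax u) //.
  by rewrite (lieC x v) (ax v) // oppr0 !scaler0 !addr0.
have /eqP -> : a == b by rewrite eqEdim addvSl dima flat_dim_le_rk.
by have := memv_add (mem0v a) (memv_line x); rewrite add0r.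
Qed.

End Flats.

(** * Root spaces for an invariant inner product *)

Section RootSpaces.
Variables (R : realType) (g : lieAlgType R) (B : g -> g -> R).
Hypothesis ipB : inner_product B.
Hypothesis lie_skew : forall x y z, B (lie z x) y = - B x (lie z y).

(** If [ad z (ad z x) = 0] then [B (ad z x) (ad z x) = - B x (ad z (ad z x))]
    vanishes, so [x] commutes with [a] and maximality applies. *)
Lemma root_space0_cartan (U a : {vspace g}) :
  cartan_subalgebra U a -> root_space U (0 : dualv a) = a.
Proof.
move=> aC; have [aU fa _] := aC; apply/vspaceP => x.
apply/idP/idP => [/root_spaceP[xU x0]|xa].
  apply: cartan_maximal aC xU _ => z za; apply/eqP.
  rewrite -(ip_eq0 ipB) lie_skew.
  have := x0 (Subvs za); rewrite /= lfunE /= expr0n oppr0 scale0r => ->.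
  by rewrite (ip_sym ipB) (ip_0l ipB) oppr0.
apply/root_spaceP; split=> [|z]; first exact: (subvP aU).
by rewrite (fa (vsval z) x) ?subvsP // linear0 lfunE /= expr0n oppr0 scale0r.
Qed.

(** The eigenvalues [b z w] of [ad z \o ad w] on [v] form a negative
    semidefinite symmetric form of rank at most one.  If [b z0 z0 != 0], then
    [b z w = - l z * l w] with [l w = b z0 w / Num.sqrt (- b z0 z0)]; if [b]
    vanishes on the diagonal, [l = 0] works. *)
Lemma common_eigenvector_root_space (U a : {vspace g}) v :
  flat a -> v \in U ->
  (forall z w, z \in a -> w \in a -> exists c, lie z (lie w v) = c *: v) ->
  exists l : dualv a, v \in root_space U l.
Proof.
move=> fa vU ev.
have [v0|v0] := eqVneq v 0.
  by exists 0; rewrite v0 mem0v.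
have Bv0 : B v v != 0 by rewrite (ip_eq0 ipB).
(* Writing the eigenvalue as a quotient of inner products makes it linear in
   [z] and [w]. *)
pose b z w := B (lie z (lie w v)) v / B v v.
have bE z w : z \in a -> w \in a -> lie z (lie w v) = b z w *: v.
  move=> za wa; have [c cE] := ev z w za wa.
  by rewrite cE /b cE (ip_Zl ipB) mulfK.
have b_le0 z : b z z <= 0.
  by rewrite /b lie_skew mulNr oppr_le0 mulr_ge0 ?invr_ge0 ?(ip_ge0 ipB).
have b_rank1 z w : z \in a -> w \in a -> b z w ^+ 2 = b z z * b w w.
  move=> za wa; have zw : lie z w = 0 by exact: fa.
  (* Swapping the two middle operators is where flatness enters. *)
  have : lie z (lie w (lie z (lie w v))) = lie z (lie z (lie w (lie w v))).
    by congr lie; apply/esym/lie_comm.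
  rewrite !bE // !linearZ /= !bE // !scalerA => /eqP.
  rewrite -subr_eq0 -scalerBl scaler_eq0 (negPf v0) orbF subr_eq0 => /eqP.
  by rewrite expr2 => ->; rewrite mulrC.
have [b0|/existsNP[z0 /not_implyP[z0a b0]]] :=
    pselect (forall z, z \in a -> b z z = 0).
  exists 0; apply/root_spaceP; split=> // z.
  by rewrite bE ?subvsP // b0 ?subvsP // lfunE /= expr0n oppr0.
pose r := Num.sqrt (- b z0 z0).
have r2 : r ^+ 2 = - b z0 z0 by rewrite sqr_sqrtr // oppr_ge0.
pose lf (z : subvs_of a) : R^o := b z0 (vsval z) / r.
have lf_lin : linear lf.
  move=> c x y; rewrite /lf /b /= lieDl lieZl linearD linearZ /=.
  by rewrite (ip_DZl ipB) !mulrDl -!mulrA.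
pose lfL : {linear subvs_of a -> R^o} :=
  HB.pack lf (GRing.isLinear.Build R (subvs_of a) R^o *:%R lf lf_lin).
exists (linfun lfL); apply/root_spaceP; split=> // z.
rewrite bE ?subvsP // lfunE /= /lf exprMn exprVn r2 b_rank1 ?subvsP //.
by rewrite invrN mulrN opprK mulrAC divff ?mul1r //; apply/eqP.
Qed.

(** [ad z \o ad z] is symmetric, with the distinct eigenvalues [- l z ^+ 2] and
    [- k z ^+ 2] on the two spaces. *)
Lemma root_spaces_orthogonal (U a : {vspace g}) (l k : dualv a) x y :
  (exists z, l z ^+ 2 != k z ^+ 2) ->
  x \in root_space U l -> y \in root_space U k -> B x y = 0.
Proof.
move=> [z lk] /root_spaceP[_ /(_ z) xl] /root_spaceP[_ /(_ z) yk].
have : B (lie (vsval z) (lie (vsval z) x)) y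
     = B x (lie (vsval z) (lie (vsval z) y)) by rewrite !lie_skew opprK.
rewrite xl yk (ip_Zl ipB) (ip_Zr ipB) !mulNr => /oppr_inj/eqP.
by rewrite -subr_eq0 -mulrBl mulf_eq0 subr_eq0 (negPf lk) => /eqP.
Qed.

Lemma directv_root_spaces (U a : {vspace g}) (s : seq (dualv a)) :
  uniq s ->
  (forall l k : dualv a, l \in s -> k \in s -> l != k ->
     exists z, l z ^+ 2 != k z ^+ 2) ->
  directv (\sum_(l <- s) root_space U l).
Proof.
elim: s => [|l s IHs] /= => [_ _|/andP[ls us] sep].
  by rewrite directvE /= !big_nil dimv0.
have ds : directv (\sum_(k <- s) root_space U k).
  by apply: IHs => // k j ks js; apply: sep; rewrite inE ?ks ?js orbT.
move: ds; rewrite !directvE /= !big_cons => /eqP <-; apply/eqP.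
apply: dimv_disjoint_sum; apply/eqP; rewrite -subv0; apply/subvP => x.
rewrite memv_cap memv0 -(ip_eq0 ipB) => /andP[xl].
suff orth t : {subset t <= s} -> forall y,
    y \in (\sum_(k <- t) root_space U k)%VS -> B x y = 0.
  by move=> xs; rewrite (orth s).
elim: t => [|k t IHt] ts y.
  by rewrite big_nil memv0 => /eqP ->; rewrite (ip_sym ipB) (ip_0l ipB).
have ks : k \in s by rewrite ts ?mem_head.
rewrite big_cons => /memv_addP[u uk [w wt ->]]; rewrite (ip_Dr ipB).
rewrite (IHt _ w wt) ?addr0; last by move=> j jt; rewrite ts // inE jt orbT.
apply: root_spaces_orthogonal xl uk.
apply: sep; rewrite ?inE ?eqxx ?ks ?orbT //.
by apply: contraNneq ls => ->.
Qed.

End RootSpaces.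

(** * Restriction of linear forms and root spaces *)

Section LinearForms.
Variables (R : realType) (g : lieAlgType R).

(** The kernels of [f - h] and [f + h] cover [V], and a vector space is not the
    union of two proper subspaces. *)
Lemma sqr_eq_linear_forms (V : vectType R) (f h : 'Hom(V, R^o)) :
  (forall x, f x ^+ 2 = h x ^+ 2) -> f = h \/ f = - h.
Proof.
move=> fh2; have pm x : f x = h x \/ f x = - h x.
  by have /eqP := fh2 x; rewrite eqf_sqr => /orP[]/eqP; [left|right].
have [fh|/existsNP[x fhx]] := pselect (forall x, f x = h x).
  by left; apply/lfunP.
right; apply/lfunP => y; rewrite opp_lfunE.
have fx : f x = - h x by case: (pm x).
have [fy|//] := pm y.
have [fxy|fxy] := pm (x + y); move: fxy; rewrite !linearD /= fx fy.
  by move/addIr => hx; case: fhx; rewrite fx.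
by move/addrI.
Qed.

Lemma restr_dual_vsproj (a a' : {vspace g}) (l : dualv a) (z : subvs_of a') :
  (a' <= a)%VS -> restr_dual a' l z = l (vsproj a (vsval z)).
Proof.
by move=> sa; apply: restr_dualE; rewrite vsprojK // (subvP sa) ?subvsP.
Qed.

Lemma restr_dualN (a a' : {vspace g}) (l : dualv a) : (a' <= a)%VS ->
  restr_dual a' (- l) = - restr_dual a' l.
Proof.
move=> sa; apply/lfunP => z.
by rewrite opp_lfunE !restr_dual_vsproj // opp_lfunE.
Qed.

Lemma root_spaceN (U a : {vspace g}) (l : dualv a) :
  root_space U (- l) = root_space U l.
Proof.
by apply/vspaceP => x; apply/idP/idP => /root_spaceP[xU xl];
  apply/root_spaceP; split=> // z; rewrite xl opp_lfunE sqrrN.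
Qed.

Lemma root_space_restr_sub (U a a' : {vspace g}) (l : dualv a) :
  (a' <= a)%VS -> (root_space U l <= root_space U (restr_dual a' l))%VS.
Proof.
move=> sa; apply/subvP => x /root_spaceP[xU xl].
apply/root_spaceP; split=> // z; rewrite restr_dual_vsproj // -xl.
by rewrite vsprojK // (subvP sa) ?subvsP.
Qed.

Lemma root_space_sub (U' U a : {vspace g}) (l : dualv a) : (U' <= U)%VS ->
  root_space U' l = (root_space U l :&: U')%VS.
Proof.
move=> sU; apply/vspaceP => x; rewrite memv_cap; apply/idP/andP.
  move=> /root_spaceP[xU' xl]; split=> //; apply/root_spaceP; split=> //.
  exact: (subvP sU).
by case=> /root_spaceP[_ xl] xU'; apply/root_spaceP.
Qed.

End LinearForms.

(** * Restricted root spaces in a compact symmetric pair *)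

Section CompactSymmetric.
Variables (R : realType) (g : lieAlgType R) (M : compact_symmetric g).

Lemma neg_killing_inner_product :
  inner_product (fun x y : g => - killing x y).
Proof.
split=> [y c x z|x y|x x0]; last by rewrite oppr_gt0 (killing_lt0 M).
  by rewrite killing_scalar opprD mulrN.
by rewrite killingC.
Qed.

Lemma neg_killing_skew (x y z : g) :
  - killing (lie z x) y = - - killing x (lie z y).
Proof. by rewrite killing_lie. Qed.

Lemma mpart_lie_lie (x y z : g) :
  x \in mpart M -> y \in mpart M -> z \in mpart M ->
  lie x (lie y z) \in mpart M.
Proof.
rewrite !mpartP => /eqP xm /eqP ym /eqP zm; rewrite !symm_lie xm ym zm.
by rewrite !lieNl (linearN (lie y)) /= opprK.
Qed.

Variables (a a' : {vspace g}) (al : dualv a').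
Hypotheses (a_sub : (a <= mpart M)%VS) (fa : flat a) (a'_sub : (a' <= a)%VS).
Hypothesis al0 : al != 0.

Let ipB := neg_killing_inner_product.

(** Compares the decomposition under [a'] with the finer one under [a]: the
    operators [ad z \o ad w] for [z], [w] in [a] commute with those that define
    the root space of [al]. *)
Lemma root_space_spanned (W := root_space (mpart M) al) :
  exists2 s : seq g, <<s>>%VS = W & forall x, x \in s ->
    forall z w, z \in a -> w \in a -> exists c, lie z (lie w x) = c *: x.
Proof.
pose P : set 'End(g) :=
  [set T | exists z w, [/\ z \in a, w \in a & T = (ad z \o ad w)%VF]].
have PE z w x : (ad z \o ad w)%VF x = lie z (lie w x).
  by rewrite comp_lfunE !adE.
have symP T : P T -> forall x y, - killing (T x) y = - killing x (T y).
  move=> [z [w [za wa ->]]] x y; rewrite !PE !neg_killing_skew opprK.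
  by rewrite (lie_comm _ (fa za wa)).
have comP T S : P T -> P S -> forall x, T (S x) = S (T x).
  move=> [z [w [za wa ->]]] [z' [w' [z'a w'a ->]]] x; rewrite !PE.
  rewrite (lie_comm _ (fa wa z'a)) (lie_comm _ (fa za z'a)).
  by rewrite (lie_comm _ (fa wa w'a)) (lie_comm _ (fa za w'a)).
have PW T : P T -> forall x, x \in W -> T x \in W.
  move=> [z [w [za wa ->]]] x /root_spaceP[xm xal]; rewrite PE.
  apply/root_spaceP; split=> [|u].
    by apply: mpart_lie_lie => //; exact: (subvP a_sub).
  have ua : vsval u \in a by rewrite (subvP a'_sub) ?subvsP.
  rewrite 2!(lie_comm _ (fa ua za)) 2!(lie_comm _ (fa ua wa)) xal.
  by rewrite !linearZ.
have [s sW sP] := span_common_eigenvectors ipB symP comP PW.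
exists s => // x xs z w za wa.
have [|c cE] := sP x xs (ad z \o ad w)%VF; first by exists z, w.
by exists c; rewrite -cE PE.
Qed.

(** The eigenvector [v] belongs to the root space of some [l]; on [a'] both
    [- l z ^+ 2] and [- al z ^+ 2] are its eigenvalue, so [l] restricts to [al]
    or [- al], and in the second case [- l] is the root looked for. *)
Lemma root_of_root_space_vector v : v != 0 -> v \in root_space (mpart M) al ->
  (forall z w, z \in a -> w \in a -> exists c, lie z (lie w v) = c *: v) ->
  exists l : dualv a, [/\ lie_roots (mpart M) a l, restr_dual a' l = al
    & v \in root_space (mpart M) l].
Proof.
move=> v0 val ev; have /root_spaceP[vm valE] := val.
have [l vl] := common_eigenvector_root_space ipB neg_killing_skew fa vm ev.
have l2 z : restr_dual a' l z ^+ 2 = al z ^+ 2.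
  have /root_spaceP[_ vlE] := subvP (root_space_restr_sub _ _ a'_sub) _ vl.
  have := vlE z; rewrite valE => /eqP; rewrite -subr_eq0 -scalerBl scaler_eq0.
  by rewrite (negPf v0) orbF subr_eq0 => /eqP/oppr_inj.
suff root_l (k : dualv a) : restr_dual a' k = al ->
    v \in root_space (mpart M) k -> lie_roots (mpart M) a k.
  have [lal|lal] := sqr_eq_linear_forms l2.
    by exists l; split=> //; exact: root_l.
  have vNl : v \in root_space (mpart M) (- l) by rewrite root_spaceN.
  have Nlal : restr_dual a' (- l) = al by rewrite restr_dualN // lal opprK.
  by exists (- l); split=> //; exact: root_l.
move=> kal vk; split.
  apply: contraNneq al0 => k0; rewrite -kal k0; apply/eqP/lfunP => z.
  by rewrite restr_dual_vsproj // !lfunE.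
by apply: contraNneq v0 => W0; rewrite -memv0 -W0.
Qed.

Lemma restricted_root_space_sum :
  exists s : seq (dualv a), [/\ uniq s,
    forall l, l \in s -> lie_roots (mpart M) a l /\ restr_dual a' l = al
    & root_space (mpart M) al = (\sum_(l <- s) root_space (mpart M) l)%VS].
Proof.
have [t tW tP] := root_space_spanned.
have tsub : {subset t <= root_space (mpart M) al}.
  by move=> x xt; rewrite -tW memv_span.
suff [s [sP sub]] : exists s : seq (dualv a),
    (forall l, l \in s -> lie_roots (mpart M) a l /\ restr_dual a' l = al) /\
    (<<t>> <= \sum_(l <- s) root_space (mpart M) l)%VS.
  exists (undup s); split=> [|l|]; rewrite ?undup_uniq ?mem_undup //.
    exact: sP.
  rewrite big_undup; last exact: addvv.
  apply/eqP; rewrite eqEsubv -{1}tW sub /= big_seq.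
  apply: (big_ind (fun U => (U <= _)%VS)) => [|U1 U2 sU1 sU2|l ls].
  - exact: sub0v.
  - by rewrite subv_add sU1.
  - by have [_ <-] := sP l ls; exact: root_space_restr_sub.
elim: t tP tsub {tW} => [|v t IHt] tP tsub.
  by exists [::]; split=> //; rewrite span_nil sub0v.
have [|x xt|s [sP sub]] := IHt.
- by move=> x xt; apply: tP; rewrite inE xt orbT.
- by apply: tsub; rewrite inE xt orbT.
have [v0|v0] := eqVneq v 0.
  exists s; split=> //; rewrite span_cons subv_add sub andbT -memvE v0.
  exact: mem0v.
have [l [lr lal vl]] :=
  root_of_root_space_vector v0 (tsub _ (mem_head _ _)) (tP _ (mem_head _ _)).
exists (l :: s); split=> [k|]; first by rewrite inE => /predU1P[->|/sP].
by rewrite span_cons big_cons addvS // -memvE.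
Qed.

(** Two roots with the same square are equal or opposite, and opposite roots
    cannot both restrict to [al] because [al != 0]; so the root spaces involved
    are independent.  A root missing from the list would have a nonzero root
    space independent of the sum and yet contained in it. *)
Lemma restricted_root_space_direct_sum :
  is_direct_sum [set l | lie_roots (mpart M) a l /\ restr_dual a' l = al]
    (fun l => root_space (mpart M) l) (root_space (mpart M) al).
Proof.
have [s [us sP sE]] := restricted_root_space_sum.
have sep (l k : dualv a) : restr_dual a' l = al -> restr_dual a' k = al ->
    l != k -> exists z, l z ^+ 2 != k z ^+ 2.
  move=> lal kal; apply: contra_neqP => /forallNP lk.
  have [//|lNk] : l = k \/ l = - k.
    by apply: sqr_eq_linear_forms => z; apply/eqP/negP => /negP /lk.
  suff : al = 0 by move/eqP; rewrite (negPf al0).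
  have alN : al = - al by rewrite -{1}lal lNk restr_dualN // kal.
  apply/eqP; move/eqP: alN.
  by rewrite -addr_eq0 -mulr2n -scaler_nat scaler_eq0 pnatr_eq0.
have dir (t : seq (dualv a)) : uniq t -> (forall l, l \in t -> restr_dual a' l = al) ->
    directv (\sum_(l <- t) root_space (mpart M) l).
  move=> ut tP; apply: (directv_root_spaces ipB neg_killing_skew) => //.
  by move=> l k lt kt; apply: sep; exact: tP.
exists s; split=> // [l|]; last by apply: dir => // l /sP[].
split=> [/sP//|[[l0 Wl0] lal]]; apply/negPn/negP => ls.
have : directv (\sum_(k <- l :: s) root_space (mpart M) k).
  by apply: dir => [|k] /=; [rewrite ls|rewrite inE => /predU1P[->|/sP[]]].
have ds : directv (\sum_(k <- s) root_space (mpart M) k).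
  by apply: dir => // k /sP[].
move: ds; rewrite !directvE /= !big_cons -sE => /eqP <-.
have /addv_idPr -> : (root_space (mpart M) l <= root_space (mpart M) al)%VS.
  by rewrite -lal root_space_restr_sub.
by rewrite -[X in X == _]add0n eqn_add2r eq_sym dimv_eq0 (negPf Wl0).
Qed.

End CompactSymmetric.

Theorem proposition2p2 (R : realType) (g : lieAlgType R)
    (M : compact_symmetric g) (m' a a' : {vspace g})
    (m'_sub : (m' <= mpart M)%VS) (m'_lts : lie_triple_system m')
    (a_cartan : cartan_subalgebra (mpart M) a)
    (a'_def : a' = (a :&: m')%VS)
    (a'_cartan : cartan_subalgebra m' a') :
  [/\ root_space m' (0 : dualv a') = a',
      lie_roots m' a' `<=`
        [set restr_dual a' l | l in [set l | lie_roots (mpart M) a l /\ restr_dual a' l != 0]]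
    & forall al : dualv a', lie_roots m' a' al ->
        exists2 W : {vspace g},
          is_direct_sum [set l | lie_roots (mpart M) a l /\ restr_dual a' l = al]
            (fun l => root_space (mpart M) l) W
          & root_space m' al = (W :&: m')%VS]
  /\
  [/\ rk m' = rk (mpart M) <-> a' = a
    & a' = a ->
        lie_roots m' a `<=` lie_roots (mpart M) a /\
        forall al : dualv a, lie_roots m' a al ->
          root_space m' al = (root_space (mpart M) al :&: m')%VS].
Proof.
have [am fa dima] := a_cartan; have [_ _ dima'] := a'_cartan.
have a'a : (a' <= a)%VS by rewrite a'_def capvSl.
split; split.
- exact: (root_space0_cartan (neg_killing_inner_product M)
    (@neg_killing_skew R g) a'_cartan).
- move=> al [al0 Wal0] /=.
  have [s [_ sP sE]] := restricted_root_space_sum am fa a'a al0.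
  case: s sP sE => [_ sE|l s sP _].
    by move: Wal0; rewrite (root_space_sub _ m'_sub) sE big_nil cap0v eqxx.
  by have [lr lal] := sP l (mem_head _ _); exists l; rewrite // lal.
- move=> al [al0 _]; exists (root_space (mpart M) al).
    exact: restricted_root_space_direct_sum.
  exact: root_space_sub.
- rewrite -dima -dima'; split=> [dE|-> //].
  by apply/eqP; rewrite eqEdim a'a dE leqnn.
move=> _; split=> [l [l0 Wl0]|l _]; last exact: root_space_sub.
split=> //; apply: contraNneq Wl0 => W0.
by rewrite (root_space_sub _ m'_sub) W0 cap0v.
Qed.
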